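(* Fix a class $c$. Let $D_c$ (positive samples) and $D_{\lnot c}$ (negative samples) be probability distributions on an input space, let $P(c),P(\lnot c)>0$ be the prior probabilities of label $c$ and of ''not $c$'', and set $\alpha_c=\frac{P(\lnot c)}{P(c)}$. Let $s_c$ be a score function with values in $[0,1]$, and let $r_c(t)=P_{x\sim D_c}(s_c(x)>t)$ be the recall, assumed (standing assumption) to be a strictly decreasing bijection from $[0,1]$ onto $[0,1]$, with inverse $r_c^{-1}$. Define the probabilistic average precision $$ap_c=\int_0^1 \frac{\beta}{\beta+\alpha_c\, P_{x'\sim D_{\lnot c}}\big(s_c(x')>r_c^{-1}(\beta)\big)}\,d\beta,$$ the detection error $\mathcal{L}^{\mathrm{Det}}_c=1-ap_c$, and the pairwise ranking error $R_c=P_{(x,x')\sim D_c\times D_{\lnot c}}\big(s_c(x)<s_c(x')\big)$ (with $x,x'$ independent). Then $$\alpha_c\log\left(\frac{1+\alpha_c}{1+\alpha_c-R_c}\right)\le \mathcal{L}^{\mathrm{Det}}_c\le \min\left(\sqrt{\tfrac{2}{3}\alpha_c R_c},\ 1-\frac{8}{9}\cdot\frac{1}{1+2\alpha_c R_c}\right).$$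
   Context: This is a probabilistic model of object detection for a single class $c$: $D_c$ is the distribution of candidate detections that are true objects of class $c$, $D_{\lnot c}$ the distribution of candidates that are not, and $s_c(x)$ is the detector's confidence score for class $c$. $\log$ is the natural logarithm. *)

(* Defs.v *)
From HB Require Import structures.
From mathcomp Require Import all_boot all_order all_algebra.
From mathcomp Require Import all_classical all_reals all_analysis.
Set Implicit Arguments. Unset Strict Implicit. Unset Printing Implicit Defensive.
Import Order.TTheory GRing.Theory Num.Theory.
Local Open Scope classical_set_scope.
Local Open Scope ring_scope.

Section defs.
Context (d : measure_display) (X : measurableType d) (R : realType).

Definition alpha_c (pc pn : R) : R := pn / pc.

Definition tail_prob (D : probability X R) (s : X -> R) (t : R) : R :=
  fine (D [set x | t < s x]).

Definition recall (Dc : probability X R) (s : X -> R) (t : R) : R :=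
  tail_prob Dc s t.

(* the inverse r_c^{-1} of the recall on [0,1] (well defined under the
   standing assumption that r_c is a bijection [0,1] -> [0,1]) *)
Definition recall_inv (Dc : probability X R) (s : X -> R) (b : R) : R :=
  xget 0 [set t | t \in `[0, 1] /\ recall Dc s t = b].

Definition ap_c (Dc Dn : probability X R) (s : X -> R) (alpha : R) : R :=
  Rintegral (@lebesgue_measure R) `[0, 1]
    (fun b : R => b / (b + alpha * tail_prob Dn s (recall_inv Dc s b))).

Definition L_det (Dc Dn : probability X R) (s : X -> R) (alpha : R) : R :=
  1 - ap_c Dc Dn s alpha.

Definition rank_err (Dc Dn : probability X R) (s : X -> R) : R :=
  fine ((Dc \x Dn)%E [set p : X * X | s p.1 < s p.2]).

End defs.

(* Main.v *)
(**
Write g(b) = P_{Dn}(s > r^-1(b)) and f(b) = b / (b + alpha g(b)). Since r is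
onto, it has no jumps, so Tonelli's theorem identifies the ranking error Rc with
the integral of g over [0,1]. Each bound then follows from a pointwise bound of
f by an affine function of g(b), integrated over [0,1]:
- lower bound on the loss: f <= 1 - w g with w(b) = alpha / (b + alpha)
  decreasing, and (w - w(1 - Rc)) (g - 1_{[1 - Rc, 1]}) >= 0 (bathtub principle);
- upper bounds: f >= 2 k sqrt b - k^2 (b + alpha g) by AM-GM. Over all of [0,1],
  the best k gives the rational bound. With k = 1 / sqrt c on [0,c] and
  f >= 1 - alpha g / c on [c,1], the loss is at most c / 6 + alpha Rc / c, and
  c = sqrt (6 alpha Rc) gives the square root bound when c <= 1; otherwise the
  rational bound is already stronger, as their difference is a multiple of
  (3 x - 1)^3, where x is the square root bound.
*)
Require Import Defs.
From HB Require Import structures.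
From mathcomp Require Import all_boot all_order all_algebra.
From mathcomp Require Import all_classical all_reals all_analysis.
From mathcomp Require Import measurable_realfun ring lra.
Import Order.TTheory GRing.Theory Num.Theory.
Import numFieldNormedType.Exports.
Local Open Scope classical_set_scope.
Local Open Scope ring_scope.

(** * Integrals over segments and comparison through primitives *)

Section RintegralItv.
Context {R : realType}.
Notation mu := (@lebesgue_measure R).
Implicit Types (a b c : R) (f g h F : R -> R).

Lemma Rintegral_itv_split a b c f : a <= c <= b ->
  mu.-integrable `[a, b] (EFin \o f) ->
  \int[mu]_(x in `[a, b]) f x =
  \int[mu]_(x in `[a, c]) f x + \int[mu]_(x in `[c, b]) f x.
Proof.
move=> /andP[ac cb] intf; apply/eqP; rewrite addrC -subr_eq; apply/eqP.
rewrite Rintegral_itvB ?bnd_simp// Rintegral_itv_obnd_cbnd//.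
apply: integrableS intf => //; apply: subset_itvr.
by rewrite bnd_simp.
Qed.

Lemma Rintegral_FTC2 a b f F : a < b ->
  {in `[a, b], continuous f} -> {in `[a, b], continuous F} ->
  (forall x, x \in `]a, b[ -> is_derive x 1 F (f x)) ->
  \int[mu]_(x in `[a, b]) f x = F b - F a.
Proof.
move=> ab cf cF dF; rewrite /Rintegral.
have aab : a \in `[a, b] by rewrite in_itv/= lexx ltW.
have bab : b \in `[a, b] by rewrite in_itv/= lexx ltW.
rewrite (@continuous_FTC2 _ f F a b)//.
- by apply: continuous_in_subspaceT => x /set_mem; exact: cf.
- split; first by move=> x /dF [].
  + exact/cvg_at_right_filter/cF.
  + exact/cvg_at_left_filter/cF.
- by move=> x /dF [_ <-]; rewrite derive1E.
Qed.

(** Common engine of all the integrated bounds. The derivative is asked only on the open interval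
    because some [F] contain a square root, handled only at positive points; [a = b] is allowed
    because cut points may hit 0 or 1. *)
Lemma Rintegral_lincomb_le_FTC2 a b (k l : R) f g h F : a <= b ->
  mu.-integrable `[a, b] (EFin \o f) -> mu.-integrable `[a, b] (EFin \o g) ->
  {in `[a, b], continuous h} -> {in `[a, b], continuous F} ->
  (forall x, x \in `]a, b[ -> is_derive x 1 F (h x)) ->
  (forall x, x \in `[a, b] -> k * f x + l * g x <= h x) ->
  k * \int[mu]_(x in `[a, b]) f x + l * \int[mu]_(x in `[a, b]) g x <= F b - F a.
Proof.
rewrite le_eqVlt => /predU1P[<- *|ab intf intg ch cF dF fgh].
  by rewrite set_itv1 !Rintegral_set1 !mulr0 addr0 subrr.
rewrite -(Rintegral_FTC2 _ _ _ _ ab ch cF dF).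
have intZ (r : R) (u : R -> R) : mu.-integrable `[a, b] (EFin \o u) ->
    mu.-integrable `[a, b] (EFin \o (fun x => r * u x)).
  exact: integrableZl.
rewrite -!RintegralZl// -RintegralD//; [|exact: intZ..].
apply: le_Rintegral => //.
- by apply: (integrableD _ (intZ k _ intf) (intZ l _ intg)).
- apply: continuous_compact_integrable; first exact: segment_compact.
  by apply: continuous_in_subspaceT => x /set_mem; exact: ch.
Qed.

Lemma integrable_itv_unit_bounded a b f : measurable_fun `[a, b] f ->
  (forall x, x \in `[a, b] -> 0 <= f x <= 1) ->
  mu.-integrable `[a, b] (EFin \o f).
Proof.
move=> mf f01; apply: measurable_bounded_integrable => //.
- by rewrite /= lebesgue_measure_itv/=; case: ifP => // _; rewrite -EFinD ltry.
- exists 1; split => // M M1 x /= xab; have /andP[f0 f1] := f01 x xab.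
  by rewrite ger0_norm// (le_trans f1)// ltW.
Qed.

End RintegralItv.

(** * Bounds on the precision integral for an abstract [g] with values in [0,1] *)

Section PrecisionIntegral.
Context {R : realType}.
Notation mu := (@lebesgue_measure R).
Implicit Types (alpha : R) (g : R -> R).

Lemma ratio_unit_interval (x y : R) : 0 <= x -> 0 <= y -> 0 <= x / (x + y) <= 1.
Proof.
move=> x0 y0; rewrite divr_ge0 ?addr_ge0//=.
have [->|xy0] := eqVneq (x + y) 0; first by rewrite invr0 mulr0.
by rewrite ler_pdivrMr ?mul1r ?lerDl// lt_def xy0 addr_ge0.
Qed.

(* AM-GM applied to x / (x + y) and k^2 (x + y). *)
Lemma ratio_ge_sqrt (k x y : R) : 0 <= x -> 0 <= y ->
  2 * k * Num.sqrt x - k ^+ 2 * (x + y) <= x / (x + y).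
Proof.
move=> x0 y0; have [->|xn0] := eqVneq x 0.
  rewrite sqrtr0 mulr0 mul0r !add0r oppr_le0.
  by rewrite mulr_ge0// sqr_ge0.
have xy0 : 0 < x + y by rewrite ltr_pwDl// lt_def xn0.
rewrite ler_pdivlMr// -subr_ge0.
have -> : x - (2 * k * Num.sqrt x - k ^+ 2 * (x + y)) * (x + y) =
    (Num.sqrt x - k * (x + y)) ^+ 2.
  by rewrite -{1}(sqr_sqrtr x0); ring.
exact: sqr_ge0.
Qed.

(** The ratio is [1 - y / (x + y)], and the denominator is at least [c]. *)
Lemma ratio_ge_linear (c x y : R) : 0 < c -> c <= x -> 0 <= y ->
  1 - y / c <= x / (x + y).
Proof.
move=> c0 cx y0; have x0 : 0 < x by exact: lt_le_trans cx.
have xy0 : 0 < x + y by rewrite ltr_pwDl.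
have -> : x / (x + y) = 1 - y / (x + y) by field; rewrite gt_eqF.
rewrite lerD2l lerN2 ler_wpM2l// lef_pV2 ?posrE//.
by rewrite (le_trans cx)// lerDl.
Qed.

Lemma continuous_mul_sqrt : continuous (fun x : R => x * Num.sqrt x).
Proof. by move=> x; apply: cvgM; [exact: cvg_id|exact: sqrt_continuous]. Qed.

Lemma is_derive_mul_sqrt (x : R) : 0 < x ->
  is_derive x 1 (fun x : R => x * Num.sqrt x) (3 / 2 * Num.sqrt x).
Proof.
move=> x0; have ds := is_derive1_sqrt x0.
apply: is_derive_eq.
rewrite /GRing.scale/= mulr1 -{1}(sqr_sqrtr (ltW x0)).
by field; rewrite gt_eqF// sqrtr_gt0.
Qed.

Section Bounds.
Variables (alpha : R) (g : R -> R).
Hypothesis alpha_gt0 : 0 < alpha.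
Hypothesis mg : measurable_fun `[0 : R, 1] g.
Hypothesis g01 : forall b : R, b \in `[0, 1] -> 0 <= g b <= 1.

Let f (b : R) := b / (b + alpha * g b).
Let rho := \int[mu]_(b in `[0, 1]) g b.

Let ag_ge0 (b : R) : b \in `[0, 1] -> 0 <= alpha * g b.
Proof. by move=> /g01 /andP[g0 _]; rewrite mulr_ge0// ltW. Qed.

Let b_ge0 (b : R) : b \in `[0, 1] -> 0 <= b.
Proof. by rewrite in_itv => /andP[]. Qed.

Let intg : mu.-integrable `[0, 1] (EFin \o g).
Proof. exact: integrable_itv_unit_bounded. Qed.

Let intf : mu.-integrable `[0, 1] (EFin \o f).
Proof.
apply: integrable_itv_unit_bounded.
  apply: measurable_funM => //.
  (* The inverse agrees with the power of exponent -1 on nonnegative reals, including at 0. *)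
  apply: (@eq_measurable_fun _ _ _ _ _ (fun b : R => (b + alpha * g b) `^ (-1))).
    move=> b /set_mem b01; rewrite powR_inv1//.
    by apply: addr_ge0; [exact: b_ge0|exact: ag_ge0].
  apply: (measurableT_comp (measurable_powR (-1))).
  by apply: measurable_funD => //; exact: measurable_funM.
by move=> b b01; apply: ratio_unit_interval; [exact: b_ge0|exact: ag_ge0].
Qed.

Let intS (c d : R) (u : R -> R) : 0 <= c -> d <= 1 ->
  mu.-integrable `[0, 1] (EFin \o u) -> mu.-integrable `[c, d] (EFin \o u).
Proof.
move=> c0 d1; apply: integrableS => // x /=; rewrite !in_itv/= => /andP[cx xd].
by rewrite (le_trans c0 cx) (le_trans xd d1).
Qed.

Lemma Rintegral_unit_interval : 0 <= rho <= 1.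
Proof.
apply/andP; split.
  by apply: Rintegral_ge0 => b /g01 /andP[].
have := @Rintegral_lincomb_le_FTC2 R 0 1 0 1 g g (cst 1) id ler01 intg intg.
rewrite mul0r add0r mul1r subr0; apply.
- by move=> x _; exact: cvg_cst.
- by move=> x _; exact: cvg_id.
- by move=> x /g01 /andP[_]; rewrite mul0r add0r mul1r.
Qed.

(* Given its integral, the extremal g is the indicator of [1 - rho, 1]. *)
Lemma Rintegral_ratio_le :
  alpha * ln ((1 + alpha) / (1 + alpha - rho)) <=
  1 - \int[mu]_(b in `[0, 1]) f b.
Proof.
have /andP[rho0 rho1] := Rintegral_unit_interval.
set a : R := 1 - rho; have a0 : 0 <= a by rewrite subr_ge0.
have a1 : a <= 1 by rewrite gerBl.
have -> : 1 + alpha - rho = a + alpha by rewrite /a; ring.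
have aalpha0 : 0 < a + alpha by rewrite ltr_wpDl.
(* Value at the cut point [a] of the decreasing weight w(b) = alpha / (b + alpha). *)
pose w0 := alpha / (a + alpha).
have f_le b : b \in `[0, 1] -> f b <= 1 - alpha / (b + alpha) * g b.
  move=> b01; have b0 := b_ge0 _ b01; have /andP[g0 g1] := g01 _ b01.
  have ba0 : 0 < b + alpha by rewrite ltr_wpDl.
  (* If the denominator vanishes then [f b = 0] by the convention on inverses, and
     [alpha * g b = 0]. *)
  have [bag0|bag0] := eqVneq (b + alpha * g b) 0.
    rewrite /f bag0 invr0 mulr0 subr_ge0 mulrAC ler_pdivrMr// mul1r.
    by rewrite -bag0 in ba0 *; rewrite (_ : alpha * g b = 0) ?ltW//;
      have := ag_ge0 _ b01; lra.
  have {}bag0 : 0 < b + alpha * g b by rewrite lt_def bag0 addr_ge0// ag_ge0.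
  have -> : f b = 1 - (b + alpha * g b)^-1 * (alpha * g b).
    by rewrite /f; field; rewrite gt_eqF.
  rewrite lerD2l lerN2 mulrAC [leRHS]mulrC ler_wpM2l ?ag_ge0//.
  by rewrite lef_pV2 ?posrE// lerD2l ler_piMr// ltW.
have c0 (x : R) : x \in `[a, 1] -> 0 < x + alpha.
  by rewrite in_itv/= => /andP[ax _]; rewrite ltr_wpDl// (le_trans a0).
(* Left of [a] the extremal indicator is 0, and w >= [w0] gives f + w0 g <= 1. *)
have lower : 1 * \int[mu]_(b in `[0, a]) f b + w0 * \int[mu]_(b in `[0, a]) g b
    <= a - 0.
  apply: (@Rintegral_lincomb_le_FTC2 _ _ _ _ _ _ _ (cst 1) id) => //.
  - exact: intS.
  - exact: intS.
  - by move=> x _; exact: cvg_cst.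
  - by move=> x _; exact: cvg_id.
  - move=> x; rewrite in_itv/= => /andP[x0 xa].
    have x01 : x \in `[0, 1] by rewrite in_itv/= x0 (le_trans xa).
    have := f_le _ x01; have /andP[g0 g1] := g01 _ x01.
    have : w0 * g x <= alpha / (x + alpha) * g x.
      rewrite ler_wpM2r// ler_wpM2l ?(ltW alpha_gt0)// lef_pV2 ?posrE ?lerD2r//.
      by rewrite ltr_wpDl.
    by rewrite mul1r; lra.
(* A primitive of 1 + w0 - w, which bounds f + w0 g right of [a], where the indicator is 1: this is
   (1 - g)(w0 - w) >= 0. *)
pose F x := (1 + w0) * x - alpha * ln (x + alpha).
have dF x : x \in `]a, 1[ -> is_derive x 1 F (1 + w0 - alpha * (x + alpha)^-1).
  move=> /subset_itv_oo_cc/c0 xa.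
  have dln : is_derive x 1 (fun y => ln (y + alpha)) (x + alpha)^-1.
    have := @is_derive1_comp R (@ln R) (fun y => y + alpha) x _ 1 (is_derive1_ln xa).
    rewrite mulr1; apply.
    by apply: is_derive_eq; rewrite addr0.
  by apply: is_derive_eq; rewrite /GRing.scale/= !(mulr0, mulr1, addr0).
have upper : 1 * \int[mu]_(b in `[a, 1]) f b + w0 * \int[mu]_(b in `[a, 1]) g b
    <= F 1 - F a.
  apply: (@Rintegral_lincomb_le_FTC2 R a 1 1 w0 f g _ F a1 _ _ _ _ dF).
  - exact: intS.
  - exact: intS.
  - move=> x /c0 xa; apply: cvgB; first exact: cvg_cst.
    apply: cvgM; first exact: cvg_cst.
    apply: cvgV; first by rewrite gt_eqF.
    by apply: cvgD; [exact: cvg_id|exact: cvg_cst].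
  - move=> x /c0 xa; apply: cvgB.
      by apply: cvgM; [exact: cvg_cst|exact: cvg_id].
    apply: cvgM; first exact: cvg_cst.
    apply: (continuous_comp (f := fun x : R => x + alpha)).
      by apply: cvgD; [exact: cvg_id|exact: cvg_cst].
    exact: continuous_ln.
  - move=> x xa1; have := c0 _ xa1; move: xa1; rewrite in_itv/= => /andP[ax x1] xa.
    have x01 : x \in `[0, 1] by rewrite in_itv/= x1 (le_trans a0).
    have := f_le _ x01; have /andP[g0 g1] := g01 _ x01.
    set w := alpha / (x + alpha); have ww0 : w <= w0.
      by rewrite ler_wpM2l ?(ltW alpha_gt0)// lef_pV2 ?posrE ?lerD2r.
    have : 0 <= (1 - g x) * (w0 - w) by rewrite mulr_ge0 ?subr_ge0.
    by rewrite mul1r; lra.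
have a01 : 0 <= a <= 1 by rewrite a0.
(* Since [1 - a = rho], the terms in [w0] on the two sides cancel, leaving only the logarithm. *)
have : 1 * \int[mu]_(b in `[0, 1]) f b + w0 * rho <=
    a - 0 + (F 1 - F a).
  rewrite /rho (Rintegral_itv_split _ _ _ _ a01 intf).
  by rewrite (Rintegral_itv_split _ _ _ _ a01 intg); lra.
rewrite ln_div ?posrE//; last by rewrite addr_gt0.
by rewrite /F /a; lra.
Qed.

(** Integral of the AM-GM bound with [k] left free, so that it serves both upper bounds on the
    loss. *)
Lemma Rintegral_ratio_ge (c k : R) : 0 < c <= 1 ->
  4 / 3 * k * (c * Num.sqrt c) - k ^+ 2 * c ^+ 2 / 2
    - k ^+ 2 * alpha * \int[mu]_(b in `[0, c]) g b <=
  \int[mu]_(b in `[0, c]) f b.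
Proof.
move=> /andP[c0 c1].
(* The signs are reversed, since the comparison lemma bounds integrals from above: it is applied to
   -f - k^2 alpha g. *)
pose F x := k ^+ 2 / 2 * (x * x) - 4 / 3 * k * (x * Num.sqrt x).
have dF x : x \in `]0, c[ -> is_derive x 1 F (k ^+ 2 * x - 2 * k * Num.sqrt x).
  rewrite in_itv/= => /andP[x0 _].
  have dm := is_derive_mul_sqrt _ x0.
  by apply: is_derive_eq; rewrite /GRing.scale/=; field.
have : -1 * \int[mu]_(b in `[0, c]) f b +
    (- (k ^+ 2 * alpha)) * \int[mu]_(b in `[0, c]) g b <= F c - F 0.
  apply: (@Rintegral_lincomb_le_FTC2 R 0 c _ _ f g _ F (ltW c0) _ _ _ _ dF).
  - exact: intS.
  - exact: intS.
  - move=> x _; apply: cvgB; apply: cvgM; [exact: cvg_cst|exact: cvg_id|..].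
      exact: cvg_cst.
    exact: sqrt_continuous.
  - move=> x _; apply: cvgB; apply: cvgM; [exact: cvg_cst| |exact: cvg_cst|].
      by apply: cvgM; exact: cvg_id.
    exact: continuous_mul_sqrt.
  - move=> x; rewrite in_itv/= => /andP[x0 xc].
    have x01 : x \in `[0, 1] by rewrite in_itv/= x0 (le_trans xc).
    have := ratio_ge_sqrt k _ _ x0 (ag_ge0 _ x01).
    by rewrite -/(f x); lra.
by rewrite /F; lra.
Qed.

Lemma Rintegral_ratio_ge_inv :
  1 - \int[mu]_(b in `[0, 1]) f b <=
  1 - 8 / 9 * (1 / (1 + 2 * alpha * rho)).
Proof.
have /andP[rho0 rho1] := Rintegral_unit_interval.
have D0 : 0 < 1 + 2 * alpha * rho.
  by rewrite ltr_pwDl// !mulr_ge0// ltW.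
rewrite lerD2l lerN2.
(* This [k] maximizes the quadratic 4/3 k - k^2 (1 + 2 alpha rho) / 2. *)
have := @Rintegral_ratio_ge 1 (4 / 3 / (1 + 2 * alpha * rho)).
rewrite ltr01 lexx => /(_ isT); apply: le_trans.
rewrite -/rho sqrtr1 le_eqVlt; apply/orP; left; apply/eqP.
by field; rewrite gt_eqF.
Qed.

(** With k^2 = 1/c, [g] gets the same coefficient alpha/c on both sides of the cut, so its two
    integrals add up to [rho]. The constants are 5c/6 on [0,c] and 1 - c on [c,1]. *)
Lemma Rintegral_ratio_ge_cut (c : R) : 0 < c <= 1 ->
  1 - \int[mu]_(b in `[0, 1]) f b <= c / 6 + alpha * rho / c.
Proof.
move=> c01; have /andP[c0 c1] := c01.
have := @Rintegral_ratio_ge c (Num.sqrt c)^-1 c01.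
rewrite exprVn (sqr_sqrtr (ltW c0)).
have -> : 4 / 3 / Num.sqrt c * (c * Num.sqrt c) = 4 / 3 * c.
  by field; rewrite gt_eqF// sqrtr_gt0.
have -> : c^-1 * c ^+ 2 / 2 = c / 2 by field; rewrite gt_eqF.
have : -1 * \int[mu]_(b in `[c, 1]) f b +
    (- (alpha / c)) * \int[mu]_(b in `[c, 1]) g b <= - 1 - - c.
  apply: (@Rintegral_lincomb_le_FTC2 _ _ _ _ _ _ _ (cst (- 1)) -%R) => //.
  - by apply: intS => //; exact: ltW.
  - by apply: intS => //; exact: ltW.
  - by move=> x _; exact: cvg_cst.
  - by move=> x _; apply: cvgN; exact: cvg_id.
  - move=> x; rewrite in_itv/= => /andP[cx x1].
    have x01 : x \in `[0, 1] by rewrite in_itv/= x1 (le_trans (ltW c0)).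
    have := ratio_ge_linear _ _ _ c0 cx (ag_ge0 _ x01).
    by rewrite -/(f x); lra.
have c01' : 0 <= c <= 1 by rewrite ltW.
rewrite /rho (Rintegral_itv_split _ _ _ _ c01' intf).
by rewrite (Rintegral_itv_split _ _ _ _ c01' intg); lra.
Qed.

Lemma Rintegral_ratio_ge_sqrt :
  1 - \int[mu]_(b in `[0, 1]) f b <= Num.sqrt (2 / 3 * alpha * rho).
Proof.
have /andP[rho0 rho1] := Rintegral_unit_interval.
have H0 : 0 <= 2 / 3 * alpha * rho by rewrite !mulr_ge0// ltW.
set x := Num.sqrt _; have x2 : x ^+ 2 = 2 / 3 * alpha * rho by rewrite sqr_sqrtr.
have x0 : 0 <= x by exact: sqrtr_ge0.
(* The optimal cut sqrt (6 alpha rho) equals [3 * x], which is admissible only when it is at most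
   1. *)
have [x13|x13] := leP 3^-1 x.
  apply: (le_trans Rintegral_ratio_ge_inv).
  have -> : 2 * alpha * rho = 3 * x ^+ 2 by rewrite x2; field.
  have D0 : 0 < 1 + 3 * x ^+ 2 by rewrite ltr_pwDl// mulr_ge0// sqr_ge0.
  rewrite mulrA mulr1 -subr_ge0.
  have -> : x - (1 - 8 / 9 / (1 + 3 * x ^+ 2)) =
      (3 * x - 1) ^+ 3 / (9 * (1 + 3 * x ^+ 2)) by field; rewrite gt_eqF.
  by rewrite divr_ge0 ?exprn_ge0 ?mulr_ge0 ?(ltW D0)//; lra.
(* Here the optimal cut would be 0, which is excluded. If the loss L were positive, the cut min(1,
   L) would give L <= L / 6. *)
have [x_eq0|xn0] := eqVneq x 0.
  have ar0 : alpha * rho = 0.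
    by move: x2; rewrite x_eq0 expr0n/= => ?; lra.
  rewrite x_eq0 leNgt; apply/negP => L0.
  pose c := Num.min 1 (1 - \int[mu]_(b in `[0, 1]) f b).
  have c01 : 0 < c <= 1 by rewrite lt_min ltr01 L0 ge_min lexx.
  have := Rintegral_ratio_ge_cut _ c01; rewrite ar0 mul0r addr0.
  have : c <= 1 - \int[mu]_(b in `[0, 1]) f b by rewrite ge_min lexx orbT.
  by lra.
have {}xn0 : 0 < x by rewrite lt_def xn0.
have c01 : 0 < 3 * x <= 1 by apply/andP; split; lra.
have := Rintegral_ratio_ge_cut _ c01.
have -> : alpha * rho = 3 / 2 * x ^+ 2 by rewrite x2; field.
have -> : 3 / 2 * x ^+ 2 / (3 * x) = x / 2 by field; rewrite gt_eqF.
by lra.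
Qed.

End Bounds.
End PrecisionIntegral.

(** * The ranking error as an integral over recall levels *)

Lemma product_measure12 {d1 d2 : measure_display} {R : realType} {T1 : measurableType d1}
    {T2 : measurableType d2} (m1 : {sigma_finite_measure set T1 -> \bar R})
    (m2 : {sigma_finite_measure set T2 -> \bar R}) (A : set (T1 * T2)) :
  measurable A -> (m1 \x m2)%E A = (m1 \x^ m2)%E A.
Proof.
(* Tonelli for the indicator of [A]: the two iterated integrals agree on rectangles, hence
   everywhere by uniqueness. *)
by move=> mA; apply: product_measure_unique => //= B C mB mC;
  rewrite product_measure2E.
Qed.

Lemma measurable_set_lt {d1 : measure_display} {R : realType} {T : measurableType d1}
    (u v : T -> R) : measurable_fun setT u -> measurable_fun setT v ->
  measurable [set x | u x < v x].
Proof.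
move=> um vm; have := measurable_fun_ltr um vm measurableT.
by move=> /(_ [set true] I); rewrite setTI.
Qed.

Section RankErr.
Context {d : measure_display} {X : measurableType d} {R : realType}.
Notation mu := (@lebesgue_measure R).
Variables (Dc Dn : probability X R) (s : X -> R).
Hypothesis ms : measurable_fun setT s.

Lemma measurable_level_gt (t : R) : measurable [set x | t < s x].
Proof.
rewrite -[X in measurable X]setTI.
have -> : [set x | t < s x] = s @^-1` `]t, +oo[.
  by apply/seteqP; split => x /=; rewrite in_itv/= andbT.
exact: ms.
Qed.

Lemma measurable_level_ge (t : R) : measurable [set x | t <= s x].
Proof.
rewrite -[X in measurable X]setTI.
have -> : [set x | t <= s x] = s @^-1` `[t, +oo[.
  by apply/seteqP; split => x /=; rewrite in_itv/= andbT.
exact: ms.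
Qed.

Lemma tail_probE (D : probability X R) (t : R) :
  (tail_prob D s t)%:E = D [set x | t < s x].
Proof.
rewrite /tail_prob fineK//; apply: fin_num_measure.
exact: measurable_level_gt.
Qed.

Lemma tail_prob_unit_interval (D : probability X R) (t : R) :
  0 <= tail_prob D s t <= 1.
Proof.
rewrite -!lee_fin tail_probE measure_ge0/=; apply: probability_le1.
exact: measurable_level_gt.
Qed.

Hypothesis s01 : forall x, 0 <= s x <= 1.
Hypothesis recall_decr :
  {in `[0, 1] &, forall t u, t < u -> recall Dc s u < recall Dc s t}.
Hypothesis recall_onto :
  forall b, b \in `[0, 1] -> exists2 t, t \in `[0, 1] & recall Dc s t = b.

Let s_in x : s x \in `[0, 1].
Proof. by rewrite in_itv/=; exact: s01. Qed.

Lemma recall_lt : {in `[0, 1] &, forall t u, (recall Dc s u < recall Dc s t) = (t < u)}.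
Proof.
move=> t u t01 u01; apply/idP/idP; last exact: recall_decr.
case: (ltgtP t u) => // [ut|->]; last by rewrite ltxx.
by move=> /lt_trans /(_ (recall_decr _ _ u01 t01 ut)); rewrite ltxx.
Qed.

Lemma recall_invP (b : R) : b \in `[0, 1] ->
  recall_inv Dc s b \in `[0, 1] /\ recall Dc s (recall_inv Dc s b) = b.
Proof.
move=> /recall_onto[t t01 tb]; rewrite /recall_inv.
exact: (@xgetI _ _ [set t | t \in `[0, 1] /\ recall Dc s t = b] t).
Qed.

Lemma recall_inv_lt (b : R) (x : X) : b \in `[0, 1] ->
  (recall_inv Dc s b < s x) = (recall Dc s (s x) < b).
Proof. by move=> /recall_invP[i01 {2}<-]; rewrite recall_lt. Qed.

(* A jump of the recall at t would leave a value that it does not attain. *)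
Lemma prob_level_ge (t : R) : t \in `[0, 1] ->
  Dc [set x | t <= s x] = (recall Dc s t)%:E.
Proof.
move=> t01; have fin : Dc [set x | t <= s x] \is a fin_num.
  by apply: fin_num_measure; exact: measurable_level_ge.
rewrite -(fineK fin); congr EFin; apply/eqP; rewrite eq_le; apply/andP; split.
  rewrite leNgt; apply/negP => jump.
  set p := fine _ in jump.
  (* The midpoint of the jump is attained at some [u < t]; then {s >= t} lies in {s > u}, which
     forces [p <= b]. *)
  pose b := (recall Dc s t + p) / 2.
  have [tb bp] : recall Dc s t < b /\ b < p by rewrite /b; split; lra.
  have p1 : p <= 1.
    rewrite -lee_fin fineK//; apply: probability_le1.
    exact: measurable_level_ge.
  have /andP[r0 _] := tail_prob_unit_interval Dc t.
  have /recall_onto[u u01 ub] : b \in `[0, 1].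
    rewrite in_itv/= (le_trans r0 (ltW tb))/=.
    exact: le_trans (ltW bp) p1.
  have ut : u < t by rewrite -recall_lt// ub.
  have : p <= b.
    rewrite -lee_fin fineK// -ub /recall tail_probE; apply: le_measure.
    - by rewrite inE; exact: measurable_level_ge.
    - by rewrite inE; exact: measurable_level_gt.
    - by move=> x /=; exact: lt_le_trans.
  by rewrite leNgt bp.
rewrite -lee_fin /recall tail_probE fineK//; apply: le_measure.
- by rewrite inE; exact: measurable_level_gt.
- by rewrite inE; exact: measurable_level_ge.
- by move=> x /= /ltW.
Qed.

Lemma prob_level_lt (t : R) : t \in `[0, 1] ->
  Dc [set x | s x < t] = (1 - recall Dc s t)%:E.
Proof.
move=> t01; have -> : [set x | s x < t] = ~` [set x | t <= s x].
  by apply/seteqP; split => x /=; rewrite real_ltNge ?num_real// => /negP.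
rewrite probability_setC ?prob_level_ge//; exact: measurable_level_ge.
Qed.

Lemma measurable_recall_comp : measurable_fun setT (recall Dc s \o s).
Proof.
apply: measurableT_comp ms; apply: nonincreasing_measurable => // t u tu.
rewrite -lee_fin /recall !tail_probE; apply: le_measure.
- by rewrite inE; exact: measurable_level_gt.
- by rewrite inE; exact: measurable_level_gt.
- by move=> x /=; exact: le_lt_trans.
Qed.

(** Slicing at a fixed negative sample leaves the event that [s] is strictly below a level, whose
    probability is known because the recall has no jumps. *)
Lemma product_measure_misranked :
  (Dc \x Dn)%E [set p : X * X | s p.1 < s p.2] = (\int[Dn]_x (1 - recall Dc s (s x))%:E)%E.
Proof.
have mA : measurable [set p : X * X | s p.1 < s p.2].
  by apply: measurable_set_lt; apply: measurableT_comp.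
rewrite product_measure12//; apply: eq_integral => y _ /=.
rewrite -prob_level_lt//; congr (Dc _).
by apply/seteqP; split => x /=; rewrite /ysection/= inE.
Qed.

(** Pairs (x', b) with b above r(s(x')). The section at [b] is {s > r^-1(b)} and the section at x'
    is ]r(s(x')), 1], so its measure computes both sides of the Tonelli argument. *)
Let under_recall := [set p : X * R | p.2 \in `[0, 1] /\ recall Dc s (s p.1) < p.2].

Let measurable_under_recall : measurable under_recall.
Proof.
apply: measurableI; last first.
  apply: measurable_set_lt; last exact: measurable_snd.
  exact: measurableT_comp measurable_recall_comp measurable_fst.
rewrite -[X in measurable X]setTI.
by apply: (@measurable_snd _ _ X R measurableT `[0, 1]%classic).
Qed.

Let ysection_under_recall (b : R) : b \in `[0, 1] ->
  Dn (ysection under_recall b) = (tail_prob Dn s (recall_inv Dc s b))%:E.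
Proof.
move=> b01; rewrite tail_probE; congr (Dn _).
apply/seteqP; split => x /=; rewrite /ysection/= inE/= recall_inv_lt//.
by case.
Qed.

(** No regularity of the chosen inverse is used: on [0,1] the function is the measure of the
    sections of a measurable set. *)
Lemma measurable_tail_recall_inv :
  measurable_fun `[0 : R, 1] (fun b : R => tail_prob Dn s (recall_inv Dc s b)).
Proof.
apply/measurable_EFinP.
apply: (@eq_measurable_fun _ _ _ _ _ (fun b => Dn (ysection under_recall b))).
  by move=> b /set_mem; exact: ysection_under_recall.
apply: measurable_funTS.
exact: (measurable_fun_ysection Dn measurable_under_recall).
Qed.

(* Both sides are the expectation of 1 - r(s(x')) under Dn, by Tonelli. *)
Lemma Rintegral_tail_recall_inv :
  \int[mu]_(b in `[0, 1]) tail_prob Dn s (recall_inv Dc s b) =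
  rank_err Dc Dn s.
Proof.
rewrite /Rintegral /rank_err product_measure_misranked; congr fine.
transitivity ((Dn \x^ mu)%E under_recall).
  rewrite integral_mkcond; apply: eq_integral => b _ /=.
  rewrite patchE; case: ifPn => [/set_mem b01|/negP b01].
    by rewrite ysection_under_recall.
  rewrite (_ : ysection _ _ = set0) ?measure0//.
  apply/seteqP; split => x //=; rewrite /ysection/= inE/= => -[b01' _].
  by apply: b01; rewrite inE.
rewrite -product_measure12//; apply: eq_integral => x _ /=.
have /andP[r0 r1] := tail_prob_unit_interval Dc (s x).
have -> : xsection under_recall x = `]recall Dc s (s x), 1]%classic.
  apply/seteqP; split => b /=; rewrite /xsection/= inE in_itv/=.
    by move=> [/= + ->]; rewrite in_itv/= => /andP[].
  by move=> /andP[rb b1]; split => //=; rewrite in_itv/= b1 (le_trans r0 (ltW rb)).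
rewrite lebesgue_measure_itv/= lte_fin.
(* If the recall is 1 the interval is empty, which matches 1 - r = 0. *)
case: ltP => [_|r1']; first by rewrite EFinB.
by rewrite (_ : recall Dc s (s x) = 1) ?subrr//; apply/eqP; rewrite eq_le r1.
Qed.

End RankErr.

Theorem theorem2 (d : measure_display) (X : measurableType d) (R : realType)
  (Dc Dn : probability X R) (s : X -> R) (pc pn : R) :
  0 < pc -> 0 < pn -> pc + pn = 1 ->
  measurable_fun setT s ->
  (forall x, 0 <= s x <= 1) ->
  (* standing assumption: r_c strictly decreasing bijection [0,1] -> [0,1] *)
  {in `[0, 1] &, forall t u, t < u -> recall Dc s u < recall Dc s t} ->
  (forall t, t \in `[0, 1] -> recall Dc s t \in `[0, 1]) ->
  (forall b, b \in `[0, 1] -> exists2 t, t \in `[0, 1] & recall Dc s t = b) ->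
  let alpha := alpha_c pc pn in
  let Rc := rank_err Dc Dn s in
  let L := L_det Dc Dn s alpha in
  alpha * ln ((1 + alpha) / (1 + alpha - Rc)) <= L /\
  L <= Num.min (Num.sqrt (2 / 3 * alpha * Rc))
               (1 - 8 / 9 * (1 / (1 + 2 * alpha * Rc))).
Proof.
move=> pc0 pn0 _ ms s01 decr _ onto alpha Rc L.
have alpha0 : 0 < alpha by rewrite divr_gt0.
have mg := measurable_tail_recall_inv Dc Dn s ms s01 decr onto.
have g01 (b : R) (_ : b \in `[0, 1]) :=
  tail_prob_unit_interval s ms Dn (recall_inv Dc s b).
have RcE := Rintegral_tail_recall_inv Dc Dn s ms s01 decr onto.
rewrite /L /L_det /ap_c /Rc -RcE; split; first exact: Rintegral_ratio_le.
rewrite le_min; apply/andP; split.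
- exact: Rintegral_ratio_ge_sqrt.
- exact: Rintegral_ratio_ge_inv.
Qed.
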